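(* Let $\alpha,\beta,\gamma,\delta>-1$ and let $n\ge1$ be an integer. Define on $\mathrm T$ $$\widetilde W(x,y)=x^\gamma(2-x-y)^\delta y^\alpha(1-y)^\beta(2-y)^{-(\gamma+\delta)},\qquad \widetilde\Phi_x(x,y)=\sqrt{\frac{x(2-x-y)}{2-y}}.$$ Then, for every $f\in\Pi_n$, $$\|\widetilde\Phi_x\,\partial_xf\|_{L^2(\mathrm T,\widetilde W)}\le\sqrt{n(n+\gamma+\delta+1)}\;\|\widetilde f\|_{L^2(\mathrm T,\widetilde W)},\qquad\text{where }\ \widetilde f(x,y)=\frac{f(x,y)}{\sqrt{2-y}}.$$ The constant is sharp, and equality is attained for $f=\mathbb P_n^n$.
   Context: $\Pi_n$ is the space of real algebraic polynomials in two variables of total degree at most $n$. The trapezoid is $\mathrm T=\{(x,y)\in\mathbb R^2:0\le y\le 1,\ 0\le x\le 2-y\}$, and $\|u\|_{L^2(\mathrm T,\widetilde W)}^2=\int_{\mathrm T}|u|^2\widetilde W\,dx\,dy$. $P_n^{(a,b)}$ denotes the classical Jacobi polynomial of degree $n$, orthogonal on $[-1,1]$ with respect to $(1-u)^a(1+u)^b$, and $\mathsf P_n^{(a,b)}(u)=P_n^{(a,b)}(1-2u)$. For each integer $k\ge0$, $\{\mathsf P_{m,k}^{(\alpha,\beta)}\}_{m\ge0}$ denotes the system of orthonormal polynomials ($\deg \mathsf P_{m,k}^{(\alpha,\beta)}=m$) on $[0,1]$ with respect to the weight $(2-y)^{2k}y^\alpha(1-y)^\beta$. For $0\le k\le n$,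 $$\mathbb P_k^n(x,y)=(2-y)^k\,\mathsf P_k^{(\gamma,\delta)}\!\left(\frac{x}{2-y}\right)\mathsf P_{n-k,k}^{(\alpha,\beta)}(y);$$ in particular $\mathbb P_n^n(x,y)=c_n(2-y)^n\,\mathsf P_n^{(\gamma,\delta)}\!\left(\frac{x}{2-y}\right)$ with a nonzero constant $c_n=\mathsf P_{0,n}^{(\alpha,\beta)}$. *)

(* Defs.v *)
From HB Require Import structures.
From mathcomp Require Import all_boot all_order all_algebra.
From mathcomp Require mpoly.

Set Implicit Arguments.
Unset Strict Implicit.
Unset Printing Implicit Defensive.

Import Order.TTheory GRing.Theory Num.Theory.

(* The notations of mpoly clash with those of the analysis library, so mpoly is
   imported only inside this module. *)
Module Bivariate.
Import mpoly.
Local Open Scope ring_scope.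

Definition eval2 (R : comNzRingType) (p : {mpoly R[2]}) (z : R * R) : R :=
  p.@[fun i : 'I_2 => if i == ord0 then z.1 else z.2].

(* [msize p] is the total degree plus one, and 0 for the zero polynomial. *)
Definition Pi (R : comNzRingType) (n : nat) (f : R * R -> R) : Prop :=
  exists2 p : {mpoly R[2]}, (msize p <= n.+1)%N & f = eval2 p.

End Bivariate.
Export Bivariate.

From mathcomp Require Import all_classical all_reals all_analysis.
Import numFieldNormedType.Exports.

Local Open Scope classical_set_scope.
Local Open Scope ring_scope.

Definition trapezoid (R : realType) : set (R * R) :=
  [set z | 0 <= z.2 <= 1 /\ 0 <= z.1 <= 2 - z.2].
Arguments trapezoid {R}.

(* Extended-real valued: +oo when [u] is not square integrable. *)
Definition L2norm (R : realType) (D : set (R * R)) (w u : R * R -> R) : \bar R :=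
  sqrte (\int[@lebesgue_measure R \x @lebesgue_measure R]_(z in D)
           (`|u z| ^+ 2 * w z)%:E)%E.

Definition partial_x (R : realType) (f : R * R -> R) (z : R * R) : R :=
  derive1 (fun x : R => f (x, z.2)) z.1.

Definition Wtilde (R : realType) (alpha beta gamma delta : R) (z : R * R) : R :=
  let x := z.1 in let y := z.2 in
  x `^ gamma * (2 - x - y) `^ delta * y `^ alpha * (1 - y) `^ beta
    * (2 - y) `^ (- (gamma + delta)).

Definition Phitilde (R : realType) (z : R * R) : R :=
  let x := z.1 in let y := z.2 in
  Num.sqrt (x * (2 - x - y) / (2 - y)).

Definition ftilde (R : realType) (f : R * R -> R) (z : R * R) : R :=
  f z / Num.sqrt (2 - z.2).

Definition wdot (R : realType) (c d : R) (w : R -> R) (p q : {poly R}) : \bar R :=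
  (\int[@lebesgue_measure R]_(u in `[c, d]) (p.[u] * q.[u] * w u)%:E)%E.

(* The last clause is the classical normalization P_m(1) = binom(m + a, m). *)
Definition jacobi_system (R : realType) (a b : R) (P : nat -> {poly R}) : Prop :=
  [/\ forall m, size (P m) = m.+1,
      forall m l, m != l ->
        wdot (-1) 1 (fun u => (1 - u) `^ a * (1 + u) `^ b) (P m) (P l) = 0%E
    & forall m, (P m).[1] = (\prod_(i < m) (a + i.+1%:R)) / m`!%:R].

Definition orthonormal_system (R : realType) (c d : R) (w : R -> R)
    (P : nat -> {poly R}) : Prop :=
  (forall m, size (P m) = m.+1) /\
  (forall m l, wdot c d w (P m) (P l) = ((m == l)%:R)%:E).

(* Each [Q k] is determined by orthonormality up to the signs of its members,
   hence a predicate on a family of systems. *)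
Definition y_systems (R : realType) (alpha beta : R)
    (Q : nat -> nat -> {poly R}) : Prop :=
  forall k, orthonormal_system 0 1
    (fun y => (2 - y) ^+ (2 * k) * y `^ alpha * (1 - y) `^ beta) (Q k).

(* [J] is the Jacobi system for (gamma, delta), evaluated at 1 - 2u;
   [Q k m] is the polynomial of degree m in the k-th system in y.  Division by
   2 - y is only meaningful for y <> 2, in particular on the trapezoid. *)
Definition PP (R : realType) (J : nat -> {poly R}) (Q : nat -> nat -> {poly R})
    (n k : nat) (z : R * R) : R :=
  let x := z.1 in let y := z.2 in
  (2 - y) ^+ k * (J k).[1 - 2 * (x / (2 - y))] * (Q k (n - k)%N).[y].

(* Main.v *)
(* On the slice of the trapezoid at height y put s = 2 - y.  Both squared norms
   are integrals over y in [0, 1], with a common nonnegative density, of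
   one-variable functionals on [0, s] for the Jacobi weight
   w(x) = x^gamma (s - x)^delta: the left one is the Dirichlet form
   int x (s - x) q'^2 w, the right one int q^2 w, where q = f(., y) has degree at
   most n.  Hence it suffices to prove, on each slice, the one-variable inequality
   with constant n (n + gamma + delta + 1).

   Write A = x (s - x) and (A w)' = B w.  Integrating (A w p)' gives the Pearson
   identity int (A p' + B p) w = 0, which makes the Jacobi operator
   D p = A p'' + B p' self-adjoint, and - D represents the Dirichlet form.  As
   D + n (n + gamma + delta + 1) lowers the degree of polynomials of degree n, the
   degree-n orthogonal polynomial is an eigenfunction, and the inequality follows
   by splitting off the top orthogonal component, by induction on n.  The
   eigenvalue equation on [-1, 1] is carried to every [0, s] by the affine
   substitution u = 1 - 2x/s, so f = (2 - y)^n P_n(1 - 2x/(2 - y)) gives equality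
   on every slice. *)
Require Import Defs.
From mathcomp Require Import all_boot all_order all_algebra.
From mathcomp Require Import ring lra.
From mathcomp Require mpoly.
Import Order.TTheory GRing.Theory Num.Theory.
Local Open Scope ring_scope.

(** * The Jacobi operator and positive functionals on polynomials *)

Section JacobiOperator.
Context {R : realFieldType}.
Variables a b g d : R.
Implicit Types (p q r : {poly R}) (m n : nat).

(** Pearson pair of the weight w = (x - a)^g (b - x)^d on [a, b], so that (A w)' = B w. *)
Definition pearsonA : {poly R} := ('X - a%:P) * (b%:P - 'X).
Definition pearsonB : {poly R} :=
  (g + 1) *: (b%:P - 'X) - (d + 1) *: ('X - a%:P).
Definition jacobi_op p := pearsonA * p^`()^`() + pearsonB * p^`().
Definition jacobi_eig n : R := n%:R * (n%:R + g + d + 1).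

(** The coefficient of x^m in [jacobi_op p] is - m (m - 1) - m (g + d + 2) = - m (m + g + d + 1)
    times that of [p], which the added multiple of [p] cancels. *)
Lemma size_jacobi_op m p : (size p <= m.+1)%N ->
  (size (jacobi_op p + jacobi_eig m *: p)%R <= m)%N.
Proof.
move=> sp; apply/leq_sizeP => j mj.
have p0 i : (m < i)%N -> p`_i = 0.
  by move=> mi; apply: nth_default; apply: leq_trans sp mi.
have -> : jacobi_op p = - (p^`()^`() * 'X * 'X) + (a + b) *: (p^`()^`() * 'X)
    - (a * b) *: p^`()^`() + ((g + 1) * b + (d + 1) * a) *: p^`()
    - (g + d + 2) *: (p^`() * 'X).
  rewrite /jacobi_op /pearsonA /pearsonB -!mul_polyC !rmorphD !rmorphM /=.
  rewrite !rmorphD !rmorph1.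
  ring.
rewrite !(coefD, coefN, coefZ) !coefMX !coef_deriv.
rewrite (p0 j.+1) ?ltnS// (p0 j.+2) ?ltnS ?(leq_trans mj)//.
rewrite !(mul0rn, mulr0, addr0, subr0, mul0r).
have e : (if j == 0%N then 0 else p`_j.-1.+1 *+ j.-1.+1) = p`_j *+ j.
  by case: j {mj} => [|j] /=; rewrite ?mulr0n.
(* The factor [j] vanishes at 0, so the truncated [j - 1] does no harm. *)
have e2 : (if j == 0%N then 0
     else if j.-1 == 0%N then 0
       else p`_j.-1.-1.+2 *+ j.-1.-1.+2 *+ j.-1.-1.+1) = p`_j *+ (j * (j - 1)).
  by case: j {mj e} => [|[|j]] //=; rewrite ?mulr0n// subn1/= mulrnA.
have e3 : (if j == 0%N then 0 else p`_j.-1.+2 *+ j.-1.+2 *+ j.-1.+1) = 0 :> R.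
  case: j {e e2} mj => [|j] //= mj; rewrite p0 ?mul0rn//.
rewrite e e2 e3 {e e2 e3} mulr0 addr0.
have [->|mj'] := eqVneq j m; last first.
  by rewrite (p0 j) ?mul0rn ?mulr0 ?oppr0 ?subr0 ?addr0// ltn_neqAle eq_sym mj'.
have -> : p`_m *+ (m * (m - 1)) = m%:R * (m%:R - 1) * p`_m.
  rewrite -[p`_m *+ _]mulr_natl natrM; case: (m) => [|k]; first by rewrite !mul0r.
  by rewrite subn1 /= -[k.+1%:R]natr1 addrK.
rewrite /jacobi_eig -[p`_m *+ m]mulr_natl; move: (m%:R) (p`_m) => u v; ring.
Qed.

Lemma size_jacobi_op_le m p : (size p <= m)%N -> (size (jacobi_op p) <= m)%N.
Proof.
case: m => [|m sp].
  rewrite leqn0 size_poly_eq0 => /eqP->.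
  by rewrite /jacobi_op !(deriv0, mulr0, addr0) size_poly0.
rewrite -(addrK (jacobi_eig m *: p) (jacobi_op p)).
rewrite (leq_trans (size_polyD _ _))// size_polyN geq_max.
by rewrite leqW ?size_jacobi_op// (leq_trans (size_scale_leq _ _)).
Qed.

Hypotheses (g_gt : -1 < g) (d_gt : -1 < d).

Lemma jacobi_eigS n : jacobi_eig n <= jacobi_eig n.+1.
Proof.
rewrite -subr_ge0 /jacobi_eig -natr1.
have n0 : 0 <= n%:R :> R by [].
move: (n%:R) n0 => t n0.
have -> : (t + 1) * (t + 1 + g + d + 1) - t * (t + g + d + 1)
  = 2 * t + (g + 1) + (d + 1) by ring.
move: g_gt d_gt => g1 d1; lra.
Qed.

Lemma jacobi_eig_ge0 n : 0 <= jacobi_eig n.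
Proof.
elim: n => [|n IHn]; first by rewrite /jacobi_eig mul0r.
exact: le_trans (jacobi_eigS n).
Qed.

(** [Lam] stands for integration against the Jacobi weight. Linearity, the Pearson identity and
    positivity on nonzero squares are all that the algebra requires of it. *)
Variable Lam : {poly R} -> R.
Hypothesis LamD : forall p q, Lam (p + q) = Lam p + Lam q.
Hypothesis LamZ : forall c p, Lam (c *: p) = c * Lam p.
Hypothesis Lam_pearson : forall p, Lam (pearsonA * p^`() + pearsonB * p) = 0.
Hypothesis Lam_gt0 : forall p, p != 0 -> 0 < Lam (p ^+ 2).

Let Lam0 : Lam 0 = 0.
Proof. by rewrite -(scale0r 0) LamZ mul0r. Qed.

Let LamN p : Lam (- p) = - Lam p.
Proof. by rewrite -scaleN1r LamZ mulN1r. Qed.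

Definition orth_below n p := forall q, (size q <= n)%N -> Lam (p * q) = 0.

(** This is the Pearson identity applied to p' q, since A (p' q)' + B p' q = A p' q' + (A p'' + B
    p') q. *)
Lemma dirichlet_form p q :
  Lam (pearsonA * p^`() * q^`()) = - Lam (jacobi_op p * q).
Proof.
apply/eqP; rewrite -subr_eq0 opprK -LamD -(Lam_pearson (p^`() * q)).
by apply/eqP; congr Lam; rewrite derivM /jacobi_op; ring.
Qed.

Lemma jacobi_op_sym p q : Lam (jacobi_op p * q) = Lam (p * jacobi_op q).
Proof.
apply: oppr_inj; rewrite -dirichlet_form [p * _]mulrC -dirichlet_form.
by congr Lam; ring.
Qed.

Lemma dirichlet_eigen n p : jacobi_op p = - (jacobi_eig n *: p) ->
  Lam (pearsonA * p^`() ^+ 2) = jacobi_eig n * Lam (p ^+ 2).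
Proof.
move=> pE; rewrite expr2 mulrA dirichlet_form pE mulNr LamN opprK.
by rewrite -scalerAl LamZ expr2.
Qed.

(** The residual r = D p + [jacobi_eig n] p has degree below n, and so has D r. By symmetry of D,
    [Lam] of r^2 is a combination of [Lam] of p (D r) and of p r; both vanish, hence r = 0 by
    positivity. *)
Lemma orth_below_eigen n p : (size p <= n.+1)%N -> orth_below n p ->
  jacobi_op p = - (jacobi_eig n *: p).
Proof.
move=> sp po; apply/eqP; rewrite -addr_eq0; apply/negPn/negP => r0.
have := Lam_gt0 _ r0; set r := _ + _ => rr.
have sr : (size r <= n)%N by exact: size_jacobi_op.
move: rr; rewrite expr2 {1}/r mulrDl LamD jacobi_op_sym -scalerAl LamZ.
by rewrite !po ?size_jacobi_op_le// mulr0 addr0 ltxx.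
Qed.

(** Gram-Schmidt by induction: the residual [P] of ['X^n] is monic of degree n and orthogonal to all
    lower degrees, and correcting the previous projection of [p] along [P] gains one degree. *)
Lemma orth_below_proj n p : exists2 r : {poly R}, (size r <= n)%N & orth_below n (p - r).
Proof.
elim: n p => [p|n IHn p].
  by exists 0; rewrite ?size_poly0// => q; rewrite leqn0 size_poly_eq0 => /eqP->;
    rewrite mulr0 Lam0.
have [r0 sr0 or0] := IHn 'X^n; have [r sr or_] := IHn p.
pose P := 'X^n - r0.
have sP : size P = n.+1.
  by rewrite /P size_polyDl size_polyXn ?size_polyN ?ltnS.
have P0 : P != 0 by rewrite -size_poly_eq0 sP.
(* Fourier coefficient of [p - r] along [P]. *)
pose c := Lam ((p - r) * P) / Lam (P ^+ 2).
exists (r + c *: P).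
  rewrite (leq_trans (size_polyD _ _))// geq_max (leq_trans sr)//=.
  by rewrite (leq_trans (size_scale_leq _ _))// sP.
have cP : Lam ((p - (r + c *: P)) * P) = 0.
  have -> : (p - (r + c *: P)) * P = (p - r) * P + (- c) *: (P ^+ 2).
    by rewrite -!mul_polyC rmorphN; ring.
  by rewrite LamD LamZ /c mulNr divfK ?subrr// gt_eqF ?Lam_gt0.
move=> q sq.
(* As [P] is monic of degree n, the second summand has degree below n. *)
have -> : q = q`_n *: P + (q - q`_n *: P) by rewrite addrC subrK.
rewrite mulrDr LamD -scalerAr LamZ cP mulr0 add0r.
have sq' : (size (q - q`_n *: P)%R <= n)%N.
  apply/leq_sizeP => j; rewrite leq_eqVlt => /predU1P[<-|nj].
    rewrite coefB coefZ.
    have -> : P`_n = 1.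
      by rewrite coefB coefXn eqxx [r0`_n]nth_default ?subr0.
    by rewrite mulr1 subrr.
  rewrite nth_default//; apply: leq_trans nj.
  rewrite (leq_trans (size_polyD _ _))// size_polyN geq_max sq.
  by rewrite (leq_trans (size_scale_leq _ _))// sP.
have -> : (p - (r + c *: P)) * (q - q`_n *: P) =
    (p - r) * (q - q`_n *: P) + (- c) *: (P * (q - q`_n *: P)).
  by rewrite -!mul_polyC rmorphN; ring.
by rewrite LamD LamZ or_// or0// mulr0 addr0.
Qed.

Lemma orth_below_exists n : exists2 p : {poly R}, size p = n.+1 & orth_below n p.
Proof.
have [r sr rP] := orth_below_proj n 'X^n.
exists ('X^n - r) => //.
by rewrite size_polyDl size_polyXn ?size_polyN ?ltnS.
Qed.

(** With p = P + r and [P] the top orthogonal component, both cross terms vanish: the one in the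
    Dirichlet form is an eigenvalue times [Lam (P * r)]. Equality holds for [P]; for [r] the
    induction hypothesis applies with a smaller eigenvalue. *)
Lemma jacobi_bernstein n p : (size p <= n.+1)%N ->
  Lam (pearsonA * p^`() ^+ 2) <= jacobi_eig n * Lam (p ^+ 2).
Proof.
elim: n p => [p sp|n IHn p sp].
  have -> : p^`() = 0 by rewrite [p]size1_polyC ?derivC.
  by rewrite expr0n mulr0 Lam0 /jacobi_eig !mul0r.
have [r sr rP] := orth_below_proj n.+1 p.
pose P := p - r.
have sP : (size P <= n.+2)%N.
  by rewrite (leq_trans (size_polyD _ _))// size_polyN geq_max sp leqW.
have PE := orth_below_eigen n.+1 P sP rP.
have -> : p = P + r by rewrite /P subrK.
have -> : pearsonA * (P + r)^`() ^+ 2 = pearsonA * P^`() ^+ 2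
    + 2 *: (pearsonA * P^`() * r^`()) + pearsonA * r^`() ^+ 2.
  by rewrite derivD -mul_polyC rmorph_nat; ring.
have -> : (P + r) ^+ 2 = P ^+ 2 + 2 *: (P * r) + r ^+ 2.
  by rewrite -mul_polyC rmorph_nat; ring.
rewrite !(LamD, LamZ) (dirichlet_eigen n.+1)// dirichlet_form PE mulNr LamN.
rewrite -scalerAl LamZ (rP r sr) !mulr0 !oppr0 mulr0 !addr0 mulrDr lerD2l.
apply: le_trans (IHn _ sr) _; rewrite ler_wpM2r ?jacobi_eigS//.
by have [->|/Lam_gt0/ltW//] := eqVneq r 0; rewrite expr0n Lam0.
Qed.
End JacobiOperator.

(** * Transport of the eigenvalue equation from [-1, 1] to [0, s] *)

Lemma jacobi_eigC (R : realFieldType) (g d : R) n :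
  jacobi_eig g d n = jacobi_eig d g n.
Proof. by rewrite /jacobi_eig -!addrA (addrCA g). Qed.

(* With u = 1 - 2x/s the endpoint x = 0 corresponds to u = 1, whence the exchange
   of the two exponents. *)
Lemma jacobi_op_comp (R : realFieldType) (g d s : R) n (p : {poly R}) :
  s != 0 ->
  jacobi_op (-1) 1 d g p = - (jacobi_eig g d n *: p) ->
  let q := p \Po (1 - (2 / s) *: 'X) in
  jacobi_op 0 s g d q = - (jacobi_eig g d n *: q).
Proof.
move=> s0 pE /=; set l := 1 - _; set q := p \Po l.
have dl : l^`() = - (2 / s)%:P by rewrite derivB derivZ derivX derivC sub0r alg_polyC.
have dq : q^`() = - (2 / s) *: (p^`() \Po l).
  by rewrite deriv_comp dl mulrN mulrC -mul_polyC rmorphN mulNr.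
have ddq : q^`()^`() = (2 / s) ^+ 2 *: (p^`()^`() \Po l).
  by rewrite dq derivZ deriv_comp dl mulrN mulrC -!mul_polyC rmorphN rmorphXn /=; ring.
have lE1 : l + 1 = (2 / s)%:P * (s%:P - 'X).
  rewrite mulrBr -rmorphM divfK// rmorph_nat mul_polyC /l; ring.
have lE2 : 1 - l = (2 / s)%:P * 'X by rewrite mul_polyC /l; ring.
(* Each derivative of [q] brings a factor - 2/s, and each linear factor of the Pearson pair composed
   with [l] brings 2/s, so the two operators are intertwined exactly. *)
have -> : jacobi_op 0 s g d q = jacobi_op (-1) 1 d g p \Po l.
  rewrite /jacobi_op ddq dq /pearsonA /pearsonB polyCN opprK.
  rewrite comp_polyD !comp_polyM !comp_polyB !comp_polyZ !comp_polyB !comp_polyD.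
  rewrite !comp_polyC comp_polyX !polyC1 lE1 lE2 -!mul_polyC subr0 polyC_exp polyCN.
  move: (_ \Po _) (_ \Po _) (_%:P) (_%:P) (_%:P) (_%:P) => u v w1 w2 w3 w4; ring.
by rewrite pE rmorphN /= comp_polyZ.
Qed.

(** * Polynomials in two variables of bounded total degree *)

(* The notations of mpoly clash with those of the analysis library. *)
Module Multinomials.
Import mpoly.

(** Regarding [f] as a polynomial in x over polynomials in y makes each slice f(., y) a one-variable
    polynomial; its degree is at most the total degree. *)
Lemma Pi_bivariate (R : comNzRingType) n (f : R * R -> R) : Pi n f ->
  exists2 P : {poly {poly R}}, (size P <= n.+1)%N &
    forall x y, f (x, y) = (map_poly (horner_eval y) P).[x].
Proof.
move=> [p sp ->].
pose F (m : 'X_{1..2}) : {poly {poly R}} :=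
  (p@_m *: 'X^(m ord_max)) *: 'X^(m ord0).
exists (\sum_(m <- msupp p) F m).
  rewrite (leq_trans (size_sum _ _ _))//; apply/bigmax_leqP_seq => m mp _.
  rewrite (leq_trans (size_scale_leq _ _))// size_polyXn ltnS.
  rewrite -ltnS (leq_trans _ sp)// (leq_ltn_trans _ (msize_mdeg_lt mp))//.
  by rewrite mdegE !big_ord_recl leq_addr.
move=> x y; rewrite /eval2 mevalE rmorph_sum horner_sum; apply: eq_bigr => m _.
rewrite /F /= map_polyZ map_polyXn hornerZ hornerXn /= /horner_eval hornerZ hornerXn.
rewrite !big_ord_recl big_ord0 mulr1 /= -mulrA [y ^+ _ * _]mulrC.
by rewrite (_ : lift ord0 ord0 = ord_max)//; exact: val_inj.
Qed.

(* The library's [msizeM_le] only gives [(msize p + msize q).+1]. *)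
Lemma msizeM_pred (R : idomainType) k (p q : {mpoly R[k]}) :
  (msize (p * q) <= (msize p + msize q).-1)%N.
Proof.
have [->|p0] := eqVneq p 0; first by rewrite mul0r mmeasure0.
have [->|q0] := eqVneq q 0; first by rewrite mulr0 mmeasure0.
by rewrite msizeM.
Qed.

(** The division-free form of c (2 - y)^n p(1 - 2x/(2 - y)): each term is a multiple of a product of
    n affine polynomials, [u] = 2 - y and [v] = 2 - y - 2x. *)
Lemma Pi_homogeneous (R : idomainType) n (c : R) (p : {poly R}) :
  Pi n (fun z => c * \sum_(k < n.+1)
    p`_k * ((2 - z.2) ^+ (n - k) * (2 - z.2 - 2 * z.1) ^+ k)).
Proof.
pose u : {mpoly R[2]} := 2%:MP - 'X_ord_max.
pose v : {mpoly R[2]} := u - 2%:MP * 'X_ord0.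
have msX (i : 'I_2) : (msize ('X_i : {mpoly R[2]}) <= 2)%N by rewrite msizeX mdeg1.
have msC (a : R) : (msize (a%:MP : {mpoly R[2]}) <= 1)%N by rewrite mmeasureC; case: eqP.
have su : (msize u <= 2)%N.
  rewrite (leq_trans (mmeasureD_le _ _ _))// geq_max mmeasureN msX andbT.
  exact: leq_trans (msC _) _.
have sv : (msize v <= 2)%N.
  rewrite (leq_trans (mmeasureD_le _ _ _))// geq_max su mmeasureN mul_mpolyC.
  by rewrite (leq_trans (msizeZ_le _ _)).
have sX (q : {mpoly R[2]}) k : (msize q <= 2)%N -> (msize (q ^+ k) <= k.+1)%N.
  move=> sq; elim: k => [|k IHk]; first by rewrite expr0 msize1.
  rewrite exprS (leq_trans (msizeM_pred _ _ _ _))//.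
  by rewrite -subn1 leq_subLR (leq_trans (leq_add sq IHk)).
exists (c *: \sum_(k < n.+1) p`_k *: (u ^+ (n - k) * v ^+ k)).
  rewrite (leq_trans (msizeZ_le _ _))// (leq_trans (mmeasure_sum _ _ _ _))//.
  apply/bigmax_leqP => k _; rewrite (leq_trans (msizeZ_le _ _))//.
  rewrite (leq_trans (msizeM_pred _ _ _ _))//.
  rewrite -subn1 leq_subLR (leq_trans (leq_add (sX _ _ su) (sX _ _ sv)))//.
  by rewrite addSn addnS subnK// -ltnS.
apply: boolp.funext => z.
rewrite /eval2 mevalZ rmorph_sum /=; congr (_ * _); apply: eq_bigr => k _.
rewrite mevalZ mevalM !rmorphXn /= /v /u !mevalB mevalM !mevalC !mevalXU.
by [].
Qed.
End Multinomials.

Set Implicit Arguments.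
Unset Strict Implicit.

Lemma jacobi_opZ (R : realFieldType) (a b g d c : R) p :
  jacobi_op a b g d (c *: p) = c *: jacobi_op a b g d p.
Proof. by rewrite /jacobi_op !derivZ -!scalerAr scalerDr. Qed.

(** A sequence with one member per degree spans all polynomials: a multiple of [J n] removes the
    leading term of [q], and induction handles the rest. *)
Lemma orth_below_basis (R : realFieldType) (Lam : {poly R} -> R)
    (J : nat -> {poly R}) n p :
  (forall m, size (J m) = m.+1) ->
  (forall p q, Lam (p + q) = Lam p + Lam q) ->
  (forall c p, Lam (c *: p) = c * Lam p) ->
  (forall m, (m < n)%N -> Lam (p * J m) = 0) -> orth_below Lam n p.
Proof.
move=> sJ LamD LamZ; elim: n => [_ q|n IHn pJ q sq].
  by rewrite leqn0 size_poly_eq0 => /eqP->; rewrite mulr0 -(scale0r 0) LamZ mul0r.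
pose c := q`_n / lead_coef (J n).
have -> : q = c *: J n + (q - c *: J n) by rewrite addrC subrK.
rewrite mulrDr LamD -scalerAr LamZ pJ// mulr0 add0r.
apply: IHn => [m mn|]; first by rewrite pJ// ltnW.
apply/leq_sizeP => j; rewrite leq_eqVlt coefB coefZ => /predU1P[<-|nj].
  have JnE : (J n)`_n = lead_coef (J n) by rewrite lead_coefE sJ.
  by rewrite JnE divfK ?subrr// lead_coef_eq0 -size_poly_eq0 sJ.
by rewrite !nth_default ?sJ ?mulr0 ?subr0// (leq_trans sq).
Qed.

Lemma horner_inj (R : numDomainType) (p q : {poly R}) :
  (forall x, p.[x] = q.[x]) -> p = q.
Proof.
move=> pq; apply/eqP; rewrite -subr_eq0; apply/negPn/negP => pq0.
pose rs : seq R := [seq i%:R | i <- iota 0 (size (p - q)%R)].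
have := max_poly_roots (rs := rs) pq0; rewrite size_map size_iota ltnn => H.
have : false by apply: H; [apply/allP => x _; rewrite rootE !hornerE pq subrr
  |rewrite map_inj_uniq ?iota_uniq//; exact: mulrIn (oner_neq0 R)].
by [].
Qed.

From mathcomp Require Import all_classical all_reals all_analysis.
From mathcomp Require Import measurable_realfun.
Import numFieldNormedType.Exports.
Import Multinomials.
Local Open Scope classical_set_scope.
Local Open Scope ring_scope.

(** * Integration against a Jacobi weight *)

(** Monotone convergence applies to the positive and negative parts; integrability keeps their
    difference well defined. *)
Lemma nondecreasing_set_cvg_integral d (T : measurableType d) (R : realType)
    (mu : {measure set T -> \bar R}) (F : (set T)^nat) (f : T -> \bar R) :
  nondecreasing_seq F -> (forall i, measurable (F i)) ->
  mu.-integrable (\bigcup_i F i) f ->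
  (\int[mu]_(x in F i) f x @[i --> \oo] --> \int[mu]_(x in \bigcup_i F i) f x)%E.
Proof.
move=> ndF mF fi; have mf := measurable_int mu fi.
have mbF : measurable (\bigcup_i F i) by exact: bigcup_measurable.
rewrite [X in _ --> X]integralE; under eq_cvg do rewrite integralE.
apply: cvgeB.
- by apply: fin_num_adde_defl; rewrite fin_numN; exact: integrable_neg_fin_num.
- apply: ge0_nondecreasing_set_cvg_integral => // i.
  by apply/measurable_funepos/(measurable_funS _ _ mf) => //; exact: bigcup_sup.
- apply: ge0_nondecreasing_set_cvg_integral => // i.
  by apply/measurable_funeneg/(measurable_funS _ _ mf) => //; exact: bigcup_sup.
Qed.

(* [f] may be unbounded at both end points, as a Jacobi weight with negative
   exponents is. *)
Lemma improper_FTC2 (R : realType) (f F : R -> R) (a b la lb : R) : a < b ->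
  (forall x, a < x < b -> is_derive x 1 F (f x)) ->
  (forall x, a < x < b -> {for x, continuous f}) ->
  F x @[x --> a^'+] --> la -> F x @[x --> b^'-] --> lb ->
  (forall x, a < x < b -> 0 <= f x) \/
    (@lebesgue_measure R).-integrable `]a, b[ (EFin \o f) ->
  (\int[@lebesgue_measure R]_(x in `]a, b[) (f x)%:E)%E = (lb - la)%:E.
Proof.
move=> ab dF cf Fa Fb fP.
(* The shift by 3 makes 2 [e n] smaller than b - a already at n = 0, so every [I n] is a
   nondegenerate interval. *)
pose e (n : nat) : R := (b - a) / n.+3%:R.
pose I (n : nat) : set R := `[a + e n, b - e n]%classic.
have e_gt0 n : 0 < e n by rewrite divr_gt0 ?subr_gt0.
have eI n : a + e n < b - e n.
  rewrite -subr_gt0 (_ : _ - _ = (b - a) * (1 - 2 / n.+3%:R)); last first.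
    by rewrite /e; field.
  by rewrite mulr_gt0 ?subr_gt0// ltr_pdivrMr// mul1r ltr_nat.
have e_cvg : e n @[n --> \oo] --> 0.
  rewrite -(mulr0 (b - a)); apply: cvgM; first exact: cvg_cst.
  have := @cvg_harmonic R; rewrite -(cvg_shiftn 2)/=.
  by under [X in X @ \oo --> _ -> _]eq_fun do rewrite addn2.
have e_ni m n : (m <= n)%N -> e n <= e m.
  move=> mn; rewrite ler_pM2l ?subr_gt0// lef_pV2 ?posrE// ler_nat.
  by rewrite !ltnS.
have ndI : nondecreasing_seq I.
  move=> m n mn; rewrite subsetEset => x; rewrite /I /= !in_itv/= => /andP[u v].
  by have := e_ni _ _ mn => w; apply/andP; split; lra.
have mI i : measurable (I i) by exact: measurable_itv.
have II n x : I n x -> a < x < b.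
  by rewrite /I/= in_itv/= => /andP[u v]; have := e_gt0 n => w; lra.
have cupI : \bigcup_i I i = `]a, b[%classic.
  apply/seteqP; split=> x; first by move=> [n _ /II]; rewrite /= in_itv.
  rewrite /= in_itv/= => /andP[ax xb].
  have m0 : 0 < Num.min (x - a) (b - x) by rewrite lt_min !subr_gt0 ax.
  have /cvgrPdist_lt/(_ _ m0) := e_cvg.
  move=> [n _ /(_ n (leqnn _))]; rewrite /= sub0r normrN gtr0_norm// lt_min.
  move=> /andP[u v]; exists n => //; rewrite /I/= in_itv/=; apply/andP; split; lra.
have mf : measurable_fun `]a, b[ f.
  apply: open_continuous_measurable_fun => [|x]; first exact: interval_open.
  by rewrite inE/= in_itv/=; exact: cf.
have FI n : (\int[@lebesgue_measure R]_(x in I n) (f x)%:E)%E =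
    (F (b - e n) - F (a + e n))%:E.
  rewrite (@continuous_FTC2 _ f F)//.
  - apply: continuous_in_subspaceT => x; rewrite inE => /II; exact: cf.
  - split.
    + move=> x /[!in_itv]/= xI; have := e_gt0 n => e0.
      have /dF [] // : a < x < b by lra.
    + apply: cvg_at_right_filter; apply: differentiable_continuous.
      apply/derivable1_diffP; have := e_gt0 n; have := eI n => e1 e0.
      have /dF [] // : a < a + e n < b by lra.
    + apply: cvg_at_left_filter; apply: differentiable_continuous.
      apply/derivable1_diffP; have := e_gt0 n; have := eI n => e1 e0.
      have /dF [] // : a < b - e n < b by lra.
  - move=> x /[!in_itv]/= xI; have := e_gt0 n => e0.
    rewrite derive1E; have xab : a < x < b by lra.
    by have := dF _ xab => dFx; rewrite derive_val.
have c1 : (\int[@lebesgue_measure R]_(x in I n) (f x)%:E @[n --> \oo] -->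
    \int[@lebesgue_measure R]_(x in `]a, b[) (f x)%:E)%E.
  rewrite -cupI; case: fP => [f0|fi].
    apply: ge0_nondecreasing_set_cvg_integral => //.
    - move=> i; apply/measurable_EFinP; apply: measurable_funS mf => //.
      by rewrite -cupI; exact: bigcup_sup.
    - by move=> i x /II xI; rewrite lee_fin f0.
  by apply: nondecreasing_set_cvg_integral => //; rewrite cupI.
(* On the compact intervals [I n] the classical theorem gives increments of [F], which tend to
   [lb - la]; limits are unique. *)
rewrite -(cvg_lim _ c1)//; apply/cvg_lim => //.
under eq_cvg do rewrite FI.
apply: cvg_EFin; first by near=> n.
rewrite /comp /=.
apply: cvgB.
  move/cvg_at_leftP: Fb; apply; split.
    by move=> n; rewrite ltrBlDr ltrDl.
  by rewrite -[X in _ --> X]subr0; apply: cvgB => //; exact: cvg_cst.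
move/cvg_at_rightP: Fa; apply; split.
  by move=> n; rewrite ltrDl.
by rewrite -[X in _ --> X]addr0; apply: cvgD => //; exact: cvg_cst.
Unshelve. all: by end_near. Qed.

(** * Real powers of the distance to an end point *)

Section powR_facts.
Context {R : realType}.
Implicit Types a b e x : R.

(** The power is monotone in one direction or the other according to the sign of [e]; the sum of
    both end values avoids the distinction. *)
Lemma powR_le_ends c l t e : 0 < c -> c <= t <= l -> t `^ e <= c `^ e + l `^ e.
Proof.
move=> c0 /andP[ct tl]; have t0 := lt_le_trans c0 ct; have l0 := lt_le_trans t0 tl.
have [e0|e0] := leP 0 e.
  apply: (@le_trans _ _ (l `^ e)); last by rewrite lerDr powR_ge0.
  by rewrite ge0_ler_powR// nnegrE ltW.
apply: (@le_trans _ _ (c `^ e)); last by rewrite lerDl powR_ge0.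
rewrite -(opprK e) !(powRN _ (- e)) lef_pV2 ?posrE ?powR_gt0//.
by rewrite ge0_ler_powR// ?nnegrE ?ltW// oppr_gt0.
Qed.

Lemma is_derive_powR_shift a x e : a < x ->
  is_derive x 1 (fun t => (t - a) `^ e) (e * (x - a) `^ (e - 1)).
Proof.
move=> ax; rewrite -[X in is_derive _ _ _ X]mulr1.
apply: (@is_derive1_comp _ (fun t => t `^ e) (fun t => t - a)).
  by apply: is_derive1_powR; rewrite subr_gt0.
by apply: is_derive_eq; rewrite subr0.
Qed.

Lemma is_derive_powR_reflect b x e : x < b ->
  is_derive x 1 (fun t => (b - t) `^ e) (- (e * (b - x) `^ (e - 1))).
Proof.
move=> xb; rewrite -[X in is_derive _ _ _ X]mulrN1.
apply: (@is_derive1_comp _ (fun t => t `^ e) (fun t => b - t)).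
  by apply: is_derive1_powR; rewrite subr_gt0.
by apply: is_derive_eq; rewrite add0r mul1r.
Qed.

Lemma is_derive_continuous (f : R -> R) x df :
  is_derive x 1 f df -> {for x, continuous f}.
Proof.
by case=> dfx _; apply: differentiable_continuous; exact/derivable1_diffP.
Qed.

Lemma powR_shift_cvg0 a e : 0 < e -> (t - a) `^ e @[t --> a^'+] --> 0.
Proof.
move=> e0; apply/cvg_at_rightP => u [au ua].
have /cvg_at_rightP/(_ (fun n => u n - a)) := powR_cvg0 e0.
apply; split=> [n|]; first by rewrite subr_gt0.
by rewrite -(subrr a); apply: cvgB => //; exact: cvg_cst.
Qed.

Lemma powR_reflect_cvg0 b e : 0 < e -> (b - t) `^ e @[t --> b^'-] --> 0.
Proof.
move=> e0; apply/cvg_at_leftP => u [ub ubb].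
have /cvg_at_rightP/(_ (fun n => b - u n)) := powR_cvg0 e0.
apply; split=> [n|]; first by rewrite subr_gt0.
by rewrite -(subrr b); apply: cvgB => //; exact: cvg_cst.
Qed.

Lemma cvg_at_left_powR_shift a x e : a < x ->
  (t - a) `^ e @[t --> x^'-] --> (x - a) `^ e.
Proof.
move=> ax; apply: cvg_at_left_filter.
exact: is_derive_continuous (is_derive_powR_shift _ ax).
Qed.

Lemma cvg_at_right_powR_reflect b x e : x < b ->
  (b - t) `^ e @[t --> x^'+] --> (b - x) `^ e.
Proof.
move=> ax; apply: cvg_at_right_filter.
exact: is_derive_continuous (is_derive_powR_reflect _ ax).
Qed.

Let mu := @lebesgue_measure R.

Lemma integral_powR_shift a b e : a < b -> -1 < e ->
  (\int[mu]_(x in `]a, b[) ((x - a) `^ e)%:E)%E =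
  ((b - a) `^ (e + 1) / (e + 1))%:E.
Proof.
move=> ab e1; have e0 : 0 < e + 1 by rewrite -ltrBlDr sub0r.
rewrite -[X in _ = X%:E]subr0.
apply: (@improper_FTC2 _ _ (fun x => (x - a) `^ (e + 1) / (e + 1))) => //.
- move=> x /andP[ax _]; apply: is_derive_eq.
    by apply: is_deriveM; exact: is_derive_powR_shift.
  rewrite scaler0 add0r addrK; apply: mulKf; exact: lt0r_neq0.
- by move=> x /andP[ax _]; exact: is_derive_continuous (is_derive_powR_shift _ ax).
- rewrite -[X in _ --> X](mul0r (e + 1)^-1); apply: cvgM; last exact: cvg_cst.
  exact: powR_shift_cvg0.
- by apply: cvgM; [exact: cvg_at_left_powR_shift|exact: cvg_cst].
- by left=> x _; exact: powR_ge0.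
Qed.

Lemma integral_powR_reflect a b e : a < b -> -1 < e ->
  (\int[mu]_(x in `]a, b[) ((b - x) `^ e)%:E)%E =
  ((b - a) `^ (e + 1) / (e + 1))%:E.
Proof.
move=> ab e1; have e0 : 0 < e + 1 by rewrite -ltrBlDr sub0r.
rewrite -[X in _ = X%:E]opprK -[X in _ = X%:E]sub0r.
apply: (@improper_FTC2 _ _ (fun x => - ((b - x) `^ (e + 1) / (e + 1)))) => //.
- move=> x /andP[_ xb]; apply: is_derive_eq.
    apply/is_deriveN/is_deriveM; first exact: is_derive_powR_reflect.
  rewrite scaler0 add0r addrK scalerN opprK; apply: mulKf; exact: lt0r_neq0.
- by move=> x /andP[_ xb]; exact: is_derive_continuous (is_derive_powR_reflect _ xb).
- by apply: cvgN; apply: cvgM; [exact: cvg_at_right_powR_reflect|exact: cvg_cst].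
- rewrite -[X in _ --> X]oppr0 -[X in _ --> - X](mul0r (e + 1)^-1).
  by apply: cvgN; apply: cvgM; [exact: powR_reflect_cvg0|exact: cvg_cst].
- by left=> x _; exact: powR_ge0.
Qed.

End powR_facts.

Lemma horner_bounded (R : realType) (a b : R) (p : {poly R}) : a <= b ->
  exists M : R, forall x, a <= x <= b -> `|p.[x]| <= M.
Proof.
move=> ab; have [|c _ cM] := @EVT_max R (fun x => `|p.[x]|) a b ab.
  apply: continuous_subspaceT => x; apply: (@continuous_comp _ _ _ (horner p)).
    exact: continuous_horner.
  exact: norm_continuous.
by exists `|p.[c]| => x xab; apply: cM; rewrite in_itv.
Qed.

Lemma measurable_horner (R : realType) (p : {poly R}) :
  measurable_fun [set: R] (horner p).
Proof. by apply: continuous_measurable_fun => x; exact: continuous_horner. Qed.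

(** Were the integral zero, [f] would vanish almost everywhere on [D], so [D] would lie in the union
    of a null set and a countable zero set. *)
Lemma lebesgue_integral_gt0 (R : realType) (D : set R) (f : R -> R) :
  measurable D -> measurable_fun D f -> (forall x, D x -> 0 <= f x) ->
  countable (D `&` [set x | f x = 0%R]) -> (0 < lebesgue_measure D)%E ->
  (0 < \int[@lebesgue_measure R]_(x in D) (f x)%:E)%E.
Proof.
move=> mD mf f0 cZ muD; rewrite lt0e; apply/andP; split; last first.
  by apply: integral_ge0 => x Dx; rewrite lee_fin f0.
apply/eqP => int0; move: muD; apply/negP; rewrite -leNgt.
have : (\int[@lebesgue_measure R]_(x in D) `|(f x)%:E| = 0)%E.
  rewrite -[RHS]int0; apply: eq_integral => x; rewrite inE => Dx.
  by rewrite gee0_abs// lee_fin f0.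
move/ae_eq_integral_abs => /(_ mD) H.
have [|N [mN N0 sN]] := H; first exact/measurable_EFinP.
have DNZ : D `<=` N `|` (D `&` [set x | f x = 0%R]).
  move=> x Dx; have [fx0|fx0] := pselect (f x = 0%R); first by right.
  by left; apply: sN => /= /(_ Dx) [].
have mZ : measurable (D `&` [set x | f x = 0%R]).
  by have := mf mD [set 0%R] (measurable_set1 _).
rewrite [leRHS](_ : _ = lebesgue_measure (N `|` (D `&` [set x | f x = 0%R]))).
  by apply: le_measure; rewrite ?inE//; exact: measurableU.
by rewrite measureU0//; exact: countable_lebesgue_measure0.
Qed.

Lemma finite_set_root (R : idomainType) (p : {poly R}) : p != 0 ->
  finite_set [set x | root p x].
Proof.
move=> p0; apply: contrapT => /(infinite_set_fset (size p))[B Bp sB].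
have rB : all (root p) (finmap.enum_fset B) by apply/allP => x /Bp.
by have := max_poly_roots p0 rB (finmap.fset_uniq B); rewrite ltnNge sB.
Qed.

Lemma measurable_fun_powR d (T : measurableType d) (R : realType) (D : set T)
    (f : T -> R) e :
  measurable_fun D f -> measurable_fun D (fun x => f x `^ e).
Proof. by move=> mf; apply: (@measurableT_comp _ _ _ _ _ _ (@powR R ^~ e)). Qed.

(** * The functional of integration against a Jacobi weight *)

Section jacobi_weight.
Context {R : realType}.
Variables a b g d : R.
Let mu := @lebesgue_measure R.

Definition jweight x : R := (x - a) `^ g * (b - x) `^ d.

Lemma jweight_ge0 x : 0 <= jweight x.
Proof. by rewrite mulr_ge0 ?powR_ge0. Qed.

Lemma jweight_gt0 x : a < x < b -> 0 < jweight x.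
Proof. by move=> /andP[ax xb]; rewrite mulr_gt0 ?powR_gt0 ?subr_gt0. Qed.

Lemma measurable_jweight : measurable_fun [set: R] jweight.
Proof.
by apply: measurable_funM; apply: measurable_fun_powR; exact: measurable_funB.
Qed.

(** Bounds t^e for t between half the length of the interval and its full length. *)
Definition jweight_cst e := ((b - a) / 2) `^ e + (b - a) `^ e.
Definition jweight_mass := jweight_cst d * ((b - a) `^ (g + 1) / (g + 1)) +
  jweight_cst g * ((b - a) `^ (d + 1) / (d + 1)).

Definition jfun (p : {poly R}) : R :=
  (\int[mu]_(x in `]a, b[) (p.[x] * jweight x))%R.

Hypotheses (ab : a < b) (g1 : -1 < g) (d1 : -1 < d).

Let b2 : 0 < (b - a) / 2.
Proof. by rewrite divr_gt0 ?subr_gt0. Qed.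

(** On each half of the interval only the factor at the nearer end point can be singular; the other
    is at most a [jweight_cst]. *)
Lemma jweight_le x : a < x < b ->
  jweight x <= jweight_cst d * (x - a) `^ g + jweight_cst g * (b - x) `^ d.
Proof.
move=> /andP[ax xb]; rewrite /jweight /jweight_cst.
have c0 e : 0 <= ((b - a) / 2) `^ e + (b - a) `^ e by rewrite addr_ge0 ?powR_ge0.
have [xm|xm] := leP (x - a) ((b - a) / 2).
  rewrite -[leLHS]addr0 lerD ?mulr_ge0 ?powR_ge0// mulrC ler_wpM2r ?powR_ge0//.
  by apply: powR_le_ends => //; apply/andP; split; lra.
rewrite -[leLHS]add0r lerD ?mulr_ge0 ?powR_ge0// ler_wpM2r ?powR_ge0//.
by apply: powR_le_ends => //; apply/andP; split; lra.
Qed.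

Lemma integral_jweight_le :
  (\int[mu]_(x in `]a, b[) (jweight x)%:E <= jweight_mass%:E)%E.
Proof.
have cge0 e : 0 <= jweight_cst e by rewrite addr_ge0 ?powR_ge0.
have m1 : measurable_fun `]a, b[ (fun x => (x - a) `^ g).
  by apply: measurable_fun_powR; exact: measurable_funB.
have m2 : measurable_fun `]a, b[ (fun x => (b - x) `^ d).
  by apply: measurable_fun_powR; exact: measurable_funB.
apply: (@le_trans _ _ (\int[mu]_(x in `]a, b[)
  ((jweight_cst d)%:E * ((x - a) `^ g)%:E + (jweight_cst g)%:E * ((b - x) `^ d)%:E)))%E.
  apply: ge0_le_integral => //.
  - by move=> x _; rewrite lee_fin jweight_ge0.
  - apply/measurable_EFinP; apply: measurable_funTS; exact: measurable_jweight.
  - by apply: emeasurable_funD; apply/measurable_EFinP; apply: measurable_funM.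
  - by move=> x; rewrite /= in_itv/= => xab; rewrite -!EFinM -EFinD lee_fin jweight_le.
rewrite ge0_integralD//=; first last.
- by apply/measurable_EFinP; apply: measurable_funM.
- by move=> x _; rewrite -EFinM lee_fin mulr_ge0 ?powR_ge0.
- by apply/measurable_EFinP; apply: measurable_funM.
- by move=> x _; rewrite -EFinM lee_fin mulr_ge0 ?powR_ge0.
rewrite !ge0_integralZl ?lee_fin ?cge0//=; try (by move=> x _; rewrite lee_fin powR_ge0);
  try exact/measurable_EFinP.
by rewrite integral_powR_shift// integral_powR_reflect.
Qed.

Lemma integrable_jweight p :
  mu.-integrable `]a, b[ (EFin \o (fun x => p.[x] * jweight x)).
Proof.
have [M pM] := horner_bounded p (ltW ab).
rewrite (_ : EFin \o _ = (EFin \o horner p) \* (EFin \o jweight))%E; last first.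
  by apply/funext => x; rewrite /= EFinM.
apply: integrableMr => //.
- by apply: measurable_funTS; exact: measurable_horner.
- exists M; split; first exact: num_real.
  move=> N MN x; rewrite /= in_itv/= => /andP[ax xb].
  by apply: le_trans (ltW MN); apply: pM; rewrite !ltW.
apply/integrableP; split.
  by apply/measurable_EFinP; apply: measurable_funTS; exact: measurable_jweight.
under eq_integral do rewrite /= ger0_norm ?jweight_ge0//.
by apply: le_lt_trans integral_jweight_le _; rewrite ltry.
Qed.

Lemma jfunE p : (jfun p)%:E = (\int[mu]_(x in `]a, b[) (p.[x] * jweight x)%:E)%E.
Proof. by rewrite /jfun/= fineK//; exact: integrable_fin_num (integrable_jweight p). Qed.

Lemma jfunE_cc p :
  (\int[mu]_(x in `[a, b]) (p.[x] * jweight x)%:E)%E = (jfun p)%:E.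
Proof.
rewrite jfunE integral_itv_bndoo//.
exact: (measurable_int mu (integrable_jweight p)).
Qed.

Lemma jfunD (p q : {poly R}) : jfun (p + q) = jfun p + jfun q.
Proof.
rewrite /jfun -RintegralD//; try exact: integrable_jweight.
by apply: eq_Rintegral => x _; rewrite hornerD mulrDl.
Qed.

Lemma jfunZ c (p : {poly R}) : jfun (c *: p) = c * jfun p.
Proof.
rewrite /jfun -RintegralZl//; last exact: integrable_jweight.
by apply: eq_Rintegral => x _; rewrite hornerZ -[LHS]mulrA.
Qed.

(* The integrand is the derivative of (x - a)^(g+1) (b - x)^(d+1) p(x). *)
Lemma jfun_pearson p : jfun (pearsonA a b * p^`() + pearsonB a b g d * p) = 0.
Proof.
apply: EFin_inj; rewrite jfunE; transitivity (0 - 0 : R)%:E; last by rewrite subrr.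
have g0 : 0 < g + 1 by rewrite -ltrBlDr sub0r.
have d0 : 0 < d + 1 by rewrite -ltrBlDr sub0r.
apply: (@improper_FTC2 _ _
  (fun x => (x - a) `^ (g + 1) * (b - x) `^ (d + 1) * p.[x])) => //.
- move=> x /andP[ax xb]; apply: is_derive_eq.
    apply: is_deriveM.
    apply: is_deriveM; first exact: is_derive_powR_shift.
    exact: is_derive_powR_reflect.
  rewrite /= !addrK -![_ *: _]/(_ * _).
  rewrite /pearsonA /pearsonB !(hornerD, hornerM, hornerN, hornerZ, hornerC, hornerX).
  rewrite /jweight.
  rewrite (@powRD _ (x - a)) ?(@powRD _ (b - x)) ?powRr1; first ring.
  - by rewrite subr_ge0 ltW.
  - by rewrite subr_ge0 ltW.
  - by rewrite gt_eqF.
  - by rewrite gt_eqF.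
- move=> x /andP[ax xb]; apply: cvgM; first exact: continuous_horner.
  apply: cvgM; first exact: is_derive_continuous (is_derive_powR_shift _ ax).
  exact: is_derive_continuous (is_derive_powR_reflect _ xb).
(* The exponents g + 1 and d + 1 are positive, so the primitive tends to 0 at both ends. *)
- rewrite -(mul0r p.[a]) -(mul0r ((b - a) `^ (d + 1))); apply: cvgM.
    by apply: cvgM; [exact: powR_shift_cvg0|exact: cvg_at_right_powR_reflect].
  by apply: cvg_at_right_filter; exact: continuous_horner.
- rewrite -(mul0r p.[b]) -(mulr0 ((b - a) `^ (g + 1))); apply: cvgM.
    by apply: cvgM; [exact: cvg_at_left_powR_shift|exact: powR_reflect_cvg0].
  by apply: cvg_at_left_filter; exact: continuous_horner.
- by right; exact: integrable_jweight.
Qed.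

Lemma jfun_gt0 (p : {poly R}) : p != 0 -> 0 < jfun (p ^+ 2).
Proof.
move=> p0; rewrite -lte_fin jfunE; apply: lebesgue_integral_gt0 => //.
- by apply/measurable_EFinP; exact: (measurable_int mu (integrable_jweight _)).
- by move=> x _; rewrite horner_exp mulr_ge0 ?sqr_ge0 ?jweight_ge0.
- apply/finite_set_countable/(sub_finite_set _ (finite_set_root p0)) => x [/=].
  rewrite in_itv/= => xab /eqP.
  by rewrite mulf_eq0 (gt_eqF (jweight_gt0 xab)) orbF horner_exp expf_eq0.
- by rewrite /mu lebesgue_measure_itv/= lte_fin ab -EFinB lte_fin subr_gt0.
Qed.

End jacobi_weight.

(** * Slices of the trapezoid *)

Lemma measurable_bivariate (R : realType) (P : {poly {poly R}}) :
  measurable_fun [set: R * R]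
    (fun z => (map_poly (horner_eval z.2) P).[z.1]).
Proof.
elim/poly_ind: P => [|P c IHP].
  by under eq_fun do rewrite rmorph0 horner0; exact: measurable_cst.
under eq_fun do rewrite rmorphD rmorphM /= map_polyX map_polyC hornerMXaddC.
apply: measurable_funD.
  by apply: measurable_funM => //; exact: measurable_fst.
apply: (@measurableT_comp _ _ _ _ _ _ (horner c) _ snd).
  exact: measurable_horner.
exact: measurable_snd.
Qed.

Lemma measurable_trapezoid (R : realType) : measurable (@trapezoid R).
Proof.
rewrite (_ : trapezoid = (snd @^-1` `[0, 1]%classic) `&`
  ((fst @^-1` `[0, +oo[%classic) `&`
   ((fun z : R * R => z.1 + z.2) @^-1` `]-oo, 2]%classic))); last first.
  apply/seteqP; split => -[x y] /=.
    move=> [yI /andP[x0 xy]]; split; first by rewrite in_itv.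
    by split=> /=; rewrite in_itv/= ?andbT// -lerBrDr.
  rewrite !in_itv/= andbT => -[yI [x0 xy]]; split=> //.
  by rewrite x0 lerBrDr.
have m1 : measurable_fun setT (@fst R R) by exact: measurable_fst.
have m2 : measurable_fun setT (@snd R R) by exact: measurable_snd.
apply: measurableI; last apply: measurableI.
- by rewrite -[X in measurable X]setTI; apply: m2.
- by rewrite -[X in measurable X]setTI; apply: m1.
- by rewrite -[X in measurable X]setTI; apply: measurable_funD.
Qed.

(** * Tonelli's theorem on the trapezoid *)

Section trapezoid_integral.
Context {R : realType}.
Let mu := @lebesgue_measure R.
Variables (g d : R) (F : R * R -> R) (V : R -> R) (r : R -> {poly R}).
Hypotheses (g1 : -1 < g) (d1 : -1 < d).
Hypotheses (mF : measurable_fun [set: R * R] F).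
Hypothesis F_ge0 : forall z, trapezoid z -> 0 <= F z.
Hypothesis FE : forall x y : R, 0 <= y <= 1 -> 0 <= x <= 2 - y ->
  F (x, y) = V y * ((r y).[x] * jweight 0 (2 - y) g d x).

Let G := ((EFin \o F) \_ trapezoid)%E.

Let mG : measurable_fun [set: R * R] G.
Proof.
apply/(measurable_restrictT _ _).1; first exact: measurable_trapezoid.
by apply: measurable_funTS; exact/measurable_EFinP.
Qed.

Let G_ge0 z : (0 <= G z)%E.
Proof. by apply: erestrict_ge0 => {}z zT /=; rewrite lee_fin F_ge0. Qed.

Let slice y : (\int[mu]_x G (x, y) =
  ((fun y => (V y * jfun 0 (2 - y) g d (r y))%:E) \_ `[0%R, 1%R]) y)%E.
Proof.
rewrite patchE; case: ifPn => [|yI]; last first.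
  apply: integral0_eq => x _; rewrite /G patchE; case: ifPn => // xy.
  by move: yI; rewrite notin_setE /= in_itv/= => -[]; move: xy; rewrite inE => -[].
rewrite inE /= in_itv/= => yI.
have sy : 0 < 2 - y by lra.
rewrite EFinM (jfunE sy g1 d1) -integralZl//; last exact: integrable_jweight.
(* The slice is a closed interval while [jfun] integrates over the open one; the end points are
   null. *)
rewrite -(@integral_itv_bndoo _ _ _ _ true false); last first.
  apply: measurable_funeM.
  exact: (measurable_int mu (integrable_jweight sy g1 d1 (r y))).
rewrite [RHS]integral_mkcond; apply: eq_integral => x _.
rewrite /G !patchE; case: ifPn => [|xy].
  rewrite inE => -[/= _ xI]; rewrite ifT; last by rewrite inE/= in_itv.
  by rewrite /= FE// EFinM.
rewrite ifF//; apply/negbTE; move: xy; rewrite !notin_setE => xy /=.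
by rewrite in_itv/= => xI; exact: xy.
Qed.

Lemma trapezoid_integral :
  (\int[mu \x mu]_(z in trapezoid) (F z)%:E =
   \int[mu]_(y in `[0%R, 1%R]) (V y * jfun 0 (2 - y) g d (r y))%:E)%E.
Proof.
rewrite integral_mkcond [RHS]integral_mkcond.
transitivity (\int[mu \x mu]_z G z)%E => //.
rewrite fubini_tonelli2//; apply: eq_integral => y _.
exact: slice.
Qed.

(** Measurability in y is inherited from the partial integrals in Tonelli's theorem, without
    studying how [jfun] depends on its end point. *)
Lemma measurable_trapezoid_slice :
  measurable_fun (`[0, 1]%classic : set R) (fun y => V y * jfun 0 (2 - y) g d (r y)).
Proof.
apply/measurable_EFinP/(measurable_restrictT _ _).2 => //.
have mS : measurable_fun [set: R] (fun y => \int[mu]_x G (x, y))%E.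
  exact: measurable_fun_fubini_tonelli_G.
by apply: eq_measurable_fun mS => y _; exact: slice.
Qed.
End trapezoid_integral.

Section slices.
Context {R : realType}.
Let mu := @lebesgue_measure R.
Variables (alpha beta gamma delta : R).
Hypotheses (hgamma : -1 < gamma) (hdelta : -1 < delta).

Let W := Wtilde alpha beta gamma delta.

(* The last factor is the [1 / (2 - y)] contained in both [Phitilde ^+ 2] and
   [ftilde f ^+ 2]. *)
Definition yweight (y : R) : R :=
  y `^ alpha * (1 - y) `^ beta * (2 - y) `^ (- (gamma + delta)) * (2 - y) `^ (-1).

Lemma yweight_ge0 y : 0 <= yweight y.
Proof. by rewrite !mulr_ge0 ?powR_ge0. Qed.

Lemma yweight_gt0 y : 0 < y < 1 -> 0 < yweight y.
Proof. by move=> /andP[y0 y1]; rewrite !mulr_gt0 ?powR_gt0//; lra. Qed.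

Lemma Wtilde_ge0 z : 0 <= W z.
Proof. by rewrite !mulr_ge0 ?powR_ge0. Qed.

Lemma measurable_Wtilde : measurable_fun [set: R * R] W.
Proof.
have m1 : measurable_fun setT (@fst R R) by exact: measurable_fst.
have m2 : measurable_fun setT (@snd R R) by exact: measurable_snd.
rewrite /W /Wtilde /=; do ?[apply: measurable_funM].
all: apply: measurable_fun_powR => //; do ?[apply: measurable_funB => //].
Qed.

Lemma Wtilde_slice x y : W (x, y) * (2 - y) `^ (-1) =
  yweight y * jweight 0 (2 - y) gamma delta x.
Proof.
rewrite /W /Wtilde /= /yweight /jweight subr0 (_ : 2 - x - y = 2 - y - x).
  ring.
by rewrite addrAC.
Qed.

Lemma measurable_powR_2B e : measurable_fun [set: R * R] (fun z => (2 - z.2) `^ e).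
Proof.
apply: measurable_fun_powR; apply: measurable_funB => //; exact: measurable_snd.
Qed.

Variable P : {poly {poly R}}.
Let q (y : R) := map_poly (horner_eval y) P.

(** Shared by both norms: [G] is the squared integrand freed of its factor 1/(2 - y), which goes
    into [yweight], and is polynomial in x on each slice. *)
Lemma L2norm_slices (u G : R * R -> R) (r : R -> {poly R}) :
  measurable_fun [set: R * R] G -> (forall z, trapezoid z -> 0 <= G z) ->
  (forall x y, G (x, y) = (r y).[x]) ->
  (forall z, trapezoid z -> u z ^+ 2 = G z * (2 - z.2) `^ (-1)) ->
  L2norm trapezoid W u = sqrte (\int[mu]_(y in `[0%R, 1%R])
    (yweight y * jfun 0 (2 - y) gamma delta (r y))%:E)%E /\
  measurable_fun (`[0%R, 1%R]%classic : set R)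
    (fun y => yweight y * jfun 0 (2 - y) gamma delta (r y)).
Proof.
move=> mG G0 GE uE.
pose F z := G z * (2 - z.2) `^ (-1) * W z.
have mF : measurable_fun setT F.
  apply: measurable_funM; last exact: measurable_Wtilde.
  by apply: measurable_funM => //; exact: measurable_powR_2B.
have F0 z : trapezoid z -> 0 <= F z.
  by move=> zT; rewrite !mulr_ge0 ?powR_ge0 ?Wtilde_ge0 ?G0.
have FE (x y : R) : 0 <= y <= 1 -> 0 <= x <= 2 - y ->
    F (x, y) = yweight y * ((r y).[x] * jweight 0 (2 - y) gamma delta x).
  move=> _ _; rewrite /F /= -mulrA [_ * W _]mulrC Wtilde_slice GE; ring.
split; last exact: measurable_trapezoid_slice FE.
congr sqrte; rewrite -(trapezoid_integral hgamma hdelta mF F0 FE).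
apply: eq_integral => z; rewrite inE => zT.
by rewrite real_normK ?num_real// uE.
Qed.

Lemma L2norm_ftilde f : (forall x y, f (x, y) = (q y).[x]) ->
  L2norm trapezoid W (ftilde f) = sqrte (\int[mu]_(y in `[0%R, 1%R])
    (yweight y * jfun 0 (2 - y) gamma delta (q y ^+ 2))%:E)%E /\
  measurable_fun (`[0%R, 1%R]%classic : set R)
    (fun y => yweight y * jfun 0 (2 - y) gamma delta (q y ^+ 2)).
Proof.
move=> fE; apply: (@L2norm_slices _ (fun z => (q z.2).[z.1] ^+ 2)).
- by apply: measurable_funX; exact: measurable_bivariate.
- by move=> z _; exact: sqr_ge0.
- by move=> x y; rewrite horner_exp.
move=> [x y] [/= /andP[y0 y1] _]; rewrite /ftilde /= exprMn fE.
have s0 : 0 <= 2 - y by lra.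
by rewrite exprVn sqr_sqrtr// powR_inv1.
Qed.

Lemma L2norm_partial f : (forall x y, f (x, y) = (q y).[x]) ->
  L2norm trapezoid W (fun z => Phitilde z * partial_x f z) =
  sqrte (\int[mu]_(y in `[0%R, 1%R]) (yweight y *
    jfun 0 (2 - y) gamma delta (pearsonA 0 (2 - y) * (q y)^`() ^+ 2))%:E)%E /\
  measurable_fun (`[0%R, 1%R]%classic : set R) (fun y => yweight y *
    jfun 0 (2 - y) gamma delta (pearsonA 0 (2 - y) * (q y)^`() ^+ 2)).
Proof.
move=> fE.
pose G (z : R * R) := z.1 * (2 - z.2 - z.1) * (q z.2)^`().[z.1] ^+ 2.
apply: (@L2norm_slices _ G).
- apply: measurable_funM.
    apply: measurable_funM; first exact: measurable_fst.
    apply: measurable_funB; last exact: measurable_fst.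
    by apply: measurable_funB => //; exact: measurable_snd.
  (* Differentiation in x commutes with evaluating the coefficients at y. *)
  apply: measurable_funX; rewrite /q; under eq_fun do rewrite deriv_map.
  exact: measurable_bivariate.
- move=> [x y] [/= _ /andP[x0 xy]].
  by rewrite /G/= mulr_ge0 ?sqr_ge0// mulr_ge0// subr_ge0.
- move=> x y; rewrite /G /pearsonA /= !(hornerM, hornerD, hornerN, hornerX, hornerC).
  by rewrite subr0 expr2.
move=> [x y] [/= /andP[y0 y1] /andP[x0 xy]]; rewrite /G /Phitilde /partial_x /=.
have s0 : 0 < 2 - y by lra.
rewrite (_ : (fun t : R => f (t, y)) = horner (q y)); last exact/funext.
rewrite -derivE exprMn sqr_sqrtr.
  rewrite powR_inv1 ?ltW// (_ : 2 - x - y = 2 - y - x); last by rewrite addrAC.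
  by rewrite mulrAC.
by apply: divr_ge0; [apply: mulr_ge0|]; lra.
Qed.

End slices.

(** * Bounds for the finiteness of the extremal norm *)

Lemma sqrte_gt0_fin (R : realType) (x : \bar R) :
  (0 < x < +oo)%E -> (0 < sqrte x < +oo)%E.
Proof.
by case: x => [r||]//; rewrite ltry andbT !lte_fin sqrtr_gt0 => ->; rewrite ltry.
Qed.

(** On the trapezoid s = 2 - y stays in [1, 2], so s and s/2 both lie in [1/2, 2], where [k e]
    bounds t^e. *)
Lemma jweight_mass_bounded (R : realType) (g d : R) : -1 < g -> -1 < d ->
  exists K, forall s, 1 <= s <= 2 -> jweight_mass 0 s g d <= K.
Proof.
move=> g1 d1; pose k (e : R) : R := (1 / 2) `^ e + 2 `^ e.
have sk (e s : R) : 1 / 2 <= s <= 2 -> s `^ e <= k e.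
  by move=> sI; apply: powR_le_ends => //; lra.
have k0 e : 0 <= k e by rewrite addr_ge0 ?powR_ge0.
have ck e s : 1 <= s <= 2 -> jweight_cst 0 s e <= 2 * k e.
  move=> sI; have -> : 2 * k e = k e + k e by ring.
  rewrite /jweight_cst subr0.
  by apply: lerD; apply: sk; lra.
exists (2 * k d * (k (g + 1) / (g + 1)) + 2 * k g * (k (d + 1) / (d + 1))) => s sI.
have g0 : 0 <= (g + 1)^-1 by rewrite invr_ge0; lra.
have d0 : 0 <= (d + 1)^-1 by rewrite invr_ge0; lra.
rewrite /jweight_mass subr0; apply: lerD; apply: ler_pM.
- by rewrite addr_ge0 ?powR_ge0.
- by rewrite mulr_ge0 ?powR_ge0.
- exact: ck.
- by rewrite ler_wpM2r//; apply: sk; lra.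
- by rewrite addr_ge0 ?powR_ge0.
- by rewrite mulr_ge0 ?powR_ge0.
- exact: ck.
- by rewrite ler_wpM2r//; apply: sk; lra.
Qed.

Lemma jfun_le (R : realType) (a b g d M : R) (q : {poly R}) :
  a < b -> -1 < g -> -1 < d -> 0 <= M ->
  (forall x, a < x < b -> 0 <= q.[x] <= M) ->
  jfun a b g d q <= M * jweight_mass a b g d.
Proof.
move=> ab g1 d1 M0 qM; rewrite -lee_fin jfunE// EFinM.
have mw : measurable_fun `]a, b[ (EFin \o jweight a b g d).
  apply/measurable_EFinP; apply: measurable_funTS; exact: measurable_jweight.
apply: le_trans (lee_wpmul2l _ (integral_jweight_le ab g1 d1)) => //.
rewrite -ge0_integralZl//; last by move=> x _; rewrite lee_fin jweight_ge0.
apply: ge0_le_integral => //.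
- move=> x; rewrite /= in_itv/= => /qM/andP[q0 _].
  by rewrite lee_fin mulr_ge0 ?jweight_ge0.
- exact: (measurable_int _ (integrable_jweight ab g1 d1 q)).
- exact: measurable_funeM.
move=> x; rewrite /= in_itv/= => /qM/andP[_ qx].
by rewrite -EFinM lee_fin ler_wpM2r ?jweight_ge0.
Qed.

(** * The inequality on the trapezoid and its extremal functions *)

Section bernstein.
Context {R : realType}.
Let mu := @lebesgue_measure R.
Variables (alpha beta gamma delta : R).
Hypotheses (hgamma : -1 < gamma) (hdelta : -1 < delta).
Let W := Wtilde alpha beta gamma delta.
Let C0 n : R := Num.sqrt (n%:R * (n%:R + gamma + delta + 1)).

Lemma C0_sqrte n (x : \bar R) :
  ((C0 n)%:E * sqrte x = sqrte ((jacobi_eig gamma delta n)%:E * x))%E.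
Proof. by rewrite sqrteM// lee_fin jacobi_eig_ge0. Qed.

Lemma bernstein_trapezoid n (f : R * R -> R) : Pi n f ->
  (L2norm trapezoid W (fun z => Phitilde z * partial_x f z)%R
   <= (C0 n)%:E * L2norm trapezoid W (ftilde f))%E.
Proof.
move=> fPi; have [P sP fE] := Pi_bivariate _ _ _ fPi.
have [-> m1] := L2norm_partial alpha beta hgamma hdelta fE.
have [-> m2] := L2norm_ftilde alpha beta hgamma hdelta fE.
have qge0 y : `[0, 1]%classic y -> 0 <= jfun 0 (2 - y) gamma delta
    (map_poly (horner_eval y) P ^+ 2).
  rewrite /= in_itv/= => y01; rewrite /jfun Rintegral_ge0// => x _.
  by rewrite horner_exp mulr_ge0 ?sqr_ge0 ?jweight_ge0.
have int_ge0 : (0 <= \int[mu]_(y in `[0%R, 1%R]) (yweight alpha beta gamma delta y *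
    jfun 0 (2 - y) gamma delta (map_poly (horner_eval y) P ^+ 2))%:E)%E.
  by apply: integral_ge0 => y yI; rewrite lee_fin mulr_ge0 ?yweight_ge0 ?qge0.
have eig0 := jacobi_eig_ge0 gamma delta hgamma hdelta n.
rewrite C0_sqrte lee_sqrt ?mule_ge0// -ge0_integralZl//; last 2 first.
- exact/measurable_EFinP.
- by move=> y yI; rewrite lee_fin mulr_ge0 ?yweight_ge0 ?qge0.
apply: ge0_le_integral => //.
- move=> y; rewrite /= in_itv/= => y01.
  rewrite lee_fin mulr_ge0 ?yweight_ge0//.
  rewrite /jfun Rintegral_ge0// => x; rewrite /= in_itv/= => x0s.
  rewrite mulr_ge0 ?jweight_ge0// /pearsonA.
  rewrite !(hornerM, hornerD, hornerN, hornerX, hornerC).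
  rewrite mulr_ge0 ?sqr_ge0// mulr_ge0//; lra.
- exact/measurable_EFinP.
- by apply: measurable_funeM; exact/measurable_EFinP.
move=> y; rewrite /= in_itv/= => y01.
rewrite -EFinM lee_fin [leRHS]mulrCA ler_wpM2l ?yweight_ge0//.
have s0 : 0 < 2 - y by lra.
apply: (@jacobi_bernstein _ 0 (2 - y)) => //.
- exact: jfunD.
- exact: jfunZ.
- exact: jfun_pearson.
- exact: jfun_gt0.
exact: leq_trans (size_poly _ _) _.
Qed.

Hypotheses (halpha : -1 < alpha) (hbeta : -1 < beta).

Lemma homogenize_horner n (p : {poly R}) s x : s != 0 -> (size p <= n.+1)%N ->
  \sum_(k < n.+1) p`_k * (s ^+ (n - k) * (s - 2 * x) ^+ k) =
  s ^+ n * p.[1 - 2 * (x / s)].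
Proof.
move=> s0 sp; rewrite (horner_coef_wide _ sp) mulr_sumr; apply: eq_bigr => k _.
have -> : s - 2 * x = s * (1 - 2 * (x / s)) by field.
have kn : (k <= n)%N by rewrite -ltnS.
have -> : s ^+ n = s ^+ (n - k) * s ^+ k by rewrite -exprD subnK.
by rewrite exprMn; ring.
Qed.

(** Every slice is a nonzero multiple of an eigenfunction, so equality holds slice by slice. The
    norm is shown positive and finite so that it can be cancelled when proving sharpness. *)
Lemma bernstein_extremal n (c : R) (p : {poly R}) : c != 0 -> size p = n.+1 ->
  jacobi_op (-1) 1 delta gamma p = - (jacobi_eig gamma delta n *: p) ->
  exists2 f : R * R -> R, Pi n f &
    [/\ forall x y, y != 2 ->
          f (x, y) = c * ((2 - y) ^+ n * p.[1 - 2 * (x / (2 - y))]),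
        (0 < L2norm trapezoid W (ftilde f) < +oo)%E
      & L2norm trapezoid W (fun z => Phitilde z * partial_x f z)%R
        = ((C0 n)%:E * L2norm trapezoid W (ftilde f))%E].
Proof.
move=> c0 sp pE.
pose f (z : R * R) : R := c * \sum_(k < n.+1)
    p`_k * ((2 - z.2) ^+ (n - k) * (2 - z.2 - 2 * z.1) ^+ k).
have fPi : Pi n f by exact: Pi_homogeneous.
have fp x y : y != 2 -> f (x, y) = c * ((2 - y) ^+ n * p.[1 - 2 * (x / (2 - y))]).
  by move=> y2; rewrite /f homogenize_horner ?sp// subr_eq0 eq_sym.
have [P sP fE] := Pi_bivariate _ _ _ fPi.
have [lE _] := L2norm_partial alpha beta hgamma hdelta fE.
have [rE m2] := L2norm_ftilde alpha beta hgamma hdelta fE.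
pose q y := map_poly (horner_eval y) P.
pose l (s : R) : {poly R} := 1 - (2 / s) *: 'X.
have s_gt0 (y : R) : 0 <= y <= 1 -> 0 < 2 - y by move=> ?; lra.
have s_neq0 (y : R) : 0 <= y <= 1 -> 2 - y != 0 by move/s_gt0/lt0r_neq0.
have y_neq2 (y : R) : 0 <= y <= 1 -> y != 2.
  by move/s_neq0; rewrite subr_eq0 eq_sym.
have qE y : 0 <= y <= 1 -> q y = (c * (2 - y) ^+ n) *: (p \Po l (2 - y)).
  move=> y01; apply: horner_inj => x; rewrite -fE fp ?y_neq2//.
  rewrite hornerZ horner_comp /l !(hornerD, hornerN, hornerZ, hornerX) -polyC1 hornerC.
  by rewrite [2 * (x / _)]mulrA [2 * x / _]mulrAC mulrA.
have qop y : 0 <= y <= 1 -> jacobi_op 0 (2 - y) gamma delta (q y) =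
    - (jacobi_eig gamma delta n *: q y).
  move=> y01; have s0 := s_neq0 _ y01.
  rewrite qE// jacobi_opZ (jacobi_op_comp _ _ _ _ _ _ s0 pE).
  by rewrite scalerN !scalerA mulrC.
have q0 y : 0 <= y <= 1 -> q y != 0.
  move=> y01; have s0 := s_neq0 _ y01.
  rewrite qE// scaler_eq0 mulf_eq0 (negPf c0) expf_eq0 (negPf s0) andbF /=.
  (* Composition with a polynomial of degree one preserves the degree of [p]. *)
  have lX : size (l (2 - y)) = 2%N.
    rewrite /l addrC size_polyDl; last first.
      rewrite size_polyN size_scale ?size_polyX ?size_poly1//.
      by rewrite mulf_neq0 ?invr_eq0.
    by rewrite size_polyN size_scale ?size_polyX// mulf_neq0 ?invr_eq0.
  by rewrite -size_poly_eq0 size_comp_poly2// sp.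
have jq y : 0 <= y <= 1 -> 0 < jfun 0 (2 - y) gamma delta (q y ^+ 2).
  by move=> y01; apply: jfun_gt0 => //; [exact: s_gt0|exact: q0].
have B0 y : 0 <= y <= 1 ->
    0 <= yweight alpha beta gamma delta y * jfun 0 (2 - y) gamma delta (q y ^+ 2).
  by move=> y01; rewrite mulr_ge0 ?yweight_ge0// ltW ?jq.
exists f => //; split=> //; last first.
  have eig0 := jacobi_eig_ge0 gamma delta hgamma hdelta n.
  rewrite lE rE C0_sqrte; congr sqrte; rewrite -ge0_integralZl//; last first.
    exact/measurable_EFinP.
  apply: eq_integral => y; rewrite inE/= in_itv/= => y01.
  rewrite -EFinM [in RHS]mulrCA; congr (_ * _)%:E.
  apply: (@dirichlet_eigen _ 0 (2 - y)) => //; have s0 := s_gt0 _ y01.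
  - exact: jfunD.
  - exact: jfunZ.
  - exact: jfun_pearson.
  exact: qop.
rewrite rE; apply: sqrte_gt0_fin; apply/andP; split.
  apply: lebesgue_integral_gt0 => //.
  (* The slice integrals are positive, so the integrand in y can vanish only where [yweight] does,
     at 0 or 1. *)
  - apply: finite_set_countable; apply: (@sub_finite_set _ _ [set 0; 1]).
      move=> y [/=]; rewrite in_itv/= => y01 /eqP.
      rewrite mulf_eq0 orbC gt_eqF ?jq//= => /eqP yw0.
      have [->|y0] := eqVneq y 0; first by left.
      have [->|y1] := eqVneq y 1; first by right.
      have /andP[y0' y1'] := y01.
      have : 0 < y < 1 by rewrite !lt_neqAle eq_sym y0 y0' y1.
      by move/(yweight_gt0 alpha beta gamma delta); rewrite yw0 ltxx.
    by rewrite finite_setU; split; exact: finite_set1.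
  - by rewrite lebesgue_measure_itv/= lte_fin ltr01 oppr0 adde0 lte_fin.
have [M pM] := @horner_bounded R (-1) 1 p ltac:(lra).
have [K sK] := jweight_mass_bounded hgamma hdelta.
have M0 : 0 <= M by apply: le_trans (normr_ge0 p.[0]) (pM 0 _); lra.
(* Bounds the squared slice: 2 - y is at most 2, and 1 - 2x/(2 - y) stays in [-1, 1], where [M]
   bounds [p]. *)
pose B := (`|c| * 2 ^+ n * M) ^+ 2.
have jqK y : 0 <= y <= 1 -> jfun 0 (2 - y) gamma delta (q y ^+ 2) <= B * K.
  move=> y01; have s0 := s_gt0 _ y01.
  apply: (@le_trans _ _ (B * jweight_mass 0 (2 - y) gamma delta)); last first.
    by rewrite ler_wpM2l ?sqr_ge0// sK//; lra.
  apply: jfun_le => //; first exact: sqr_ge0.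
  move=> x x0s; rewrite horner_exp sqr_ge0/= -[X in X <= _]real_normK ?num_real//.
  rewrite ler_sqr ?nnegrE ?mulr_ge0 ?exprn_ge0//.
  rewrite -fE fp ?y_neq2//.
  rewrite !normrM -mulrA ler_wpM2l// ler_pM//.
    rewrite normrX (gtr0_norm s0); apply: lerXn2r; rewrite ?nnegrE; lra.
  apply: pM.
  have : 0 <= x / (2 - y) <= 1.
    rewrite divr_ge0 ?ler_pdivrMr//=; lra.
  lra.
pose k e : R := 1 `^ e + 2 `^ e.
have sk (e s : R) : 1 <= s <= 2 -> s `^ e <= k e by exact: powR_le_ends.
(* Bounds everything except y^alpha (1 - y)^beta, which is the integrable Jacobi weight on
   [0, 1]. *)
pose D := B * K * k (- (gamma + delta)) * k (-1).
have a01 : (0 : R) < 1 by [].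
apply: (@le_lt_trans _ _ (\int[mu]_(y in `[0%R, 1%R])
    ((D%:P).[y] * jweight 0 1 alpha beta y)%:E)%E); last first.
  by rewrite jfunE_cc// ltry.
apply: ge0_le_integral => //.
- exact/measurable_EFinP.
- apply/measurable_EFinP; apply: measurable_funTS; apply: measurable_funM.
    exact: measurable_horner.
  exact: measurable_jweight.
move=> y; rewrite /= in_itv/= => y01; rewrite lee_fin hornerC.
have y12 : 1 <= 2 - y <= 2 by lra.
have -> : yweight alpha beta gamma delta y * jfun 0 (2 - y) gamma delta (q y ^+ 2)
    = jfun 0 (2 - y) gamma delta (q y ^+ 2) * (2 - y) `^ (- (gamma + delta))
      * (2 - y) `^ (-1) * jweight 0 1 alpha beta y.
  by rewrite /yweight /jweight subr0; ring.
rewrite ler_wpM2r ?jweight_ge0// ler_pM ?sk ?powR_ge0//.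
  by rewrite mulr_ge0 ?powR_ge0// ltW ?jq.
by rewrite ler_pM ?sk ?powR_ge0 ?jqK// ltW ?jq.
Qed.
End bernstein.

(** * Inequality, sharpness and the extremal polynomial *)

Unset Implicit Arguments.
Set Strict Implicit.

Theorem corollary5p2 (R : realType) (alpha beta gamma delta : R) (n : nat)
    (halpha : -1 < alpha) (hbeta : -1 < beta)
    (hgamma : -1 < gamma) (hdelta : -1 < delta) (hn : (1 <= n)%N) :
  let W := Wtilde alpha beta gamma delta in
  let lhs (f : R * R -> R) :=
    L2norm trapezoid W (fun z => Phitilde z * partial_x f z) in
  let rhs (f : R * R -> R) := L2norm trapezoid W (ftilde f) in
  let C0 : R := Num.sqrt (n%:R * (n%:R + gamma + delta + 1)) in
  [/\ forall f, Pi n f -> (lhs f <= C0%:E * rhs f)%E,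
      forall C : R,
        (forall f, Pi n f -> (lhs f <= C%:E * rhs f)%E) -> C0 <= C
    & forall (J : nat -> {poly R}) (Q : nat -> nat -> {poly R}),
        jacobi_system gamma delta J -> y_systems alpha beta Q ->
        exists2 f : R * R -> R, Pi n f &
          [/\ {in trapezoid, f =1 PP J Q n n},
              (0 < rhs f < +oo)%E
            & lhs f = (C0%:E * rhs f)%E]].
Proof.
(* The exponents are swapped because [jweight] lists the left end point first: this weight is (1 +
   u)^delta (1 - u)^gamma. *)
move=> W lhs rhs C0; pose Lam := jfun (-1) 1 delta gamma.
have N11 : (-1 : R) < 1 by lra.
have eigen (p : {poly R}) : size p = n.+1 -> orth_below Lam n p ->
    jacobi_op (-1) 1 delta gamma p = - (jacobi_eig gamma delta n *: p).
  move=> sp po; rewrite jacobi_eigC; apply: (@orth_below_eigen _ _ _ _ _ Lam) => //.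
  - exact: jfunD.
  - exact: jfunZ.
  - exact: jfun_pearson.
  - exact: jfun_gt0.
  - by rewrite sp.
split.
- by move=> f; exact: bernstein_trapezoid.
- move=> C CP.
  (* Gram-Schmidt supplies an orthogonal polynomial of degree n, hence an extremal function against
     which [C] is tested. *)
  have [p sp po] : exists2 p : {poly R}, size p = n.+1 & orth_below Lam n p.
    apply: orth_below_exists.
    - exact: jfunD.
    - exact: jfunZ.
    - exact: jfun_gt0.
  have [f fPi [_ r0 lr]] := bernstein_extremal hgamma hdelta halpha hbeta
    (oner_neq0 R) sp (eigen p sp po).
  have := CP f fPi; rewrite /lhs lr /rhs.
  move: r0; case: (L2norm _ _ _) => [r||]; rewrite ?ltxx ?andbF//.
  rewrite ltry andbT lte_fin => r0.
  by rewrite -!EFinM lee_fin ler_pM2r.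
move=> J Q [sJ oJ _] QP.
have [sQ _] := QP n.
(* For k = n the factor in y has degree 0: it is the nonzero constant [c] multiplying the extremal
   function. *)
have /size_poly1P[c c0 Qc] : size (Q n 0%N) == 1%N by rewrite sQ.
have JJ m l : m != l -> Lam (J m * J l) = 0.
  move=> ml; apply: EFin_inj; rewrite -jfunE_cc//.
  rewrite -[RHS](oJ _ _ ml); apply: eq_integral => u _.
  by rewrite hornerM /jweight opprK [_ `^ delta * _]mulrC (addrC u).
have Jo : orth_below Lam n (J n).
  apply: (orth_below_basis sJ).
  - exact: jfunD.
  - exact: jfunZ.
  - by move=> m mn; rewrite JJ// gtn_eqF.
have [f fPi [fE r0 lr]] := bernstein_extremal hgamma hdelta halpha hbeta
  c0 (sJ n) (eigen _ (sJ n) Jo).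
exists f => //; split=> //.
move=> [x y]; rewrite inE => -[/= /andP[y0 y1] _].
rewrite fE; last by apply/eqP => y2; lra.
by rewrite /PP /= subnn Qc hornerC mulrC.
Qed.
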